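(* Let $E$ be a finite set, let $\mathbb{G}$ be a finite $E$-group and let $N\ge 2$. Then there exists a finite $E$-group $\hat{\mathbb{G}}$ with $\hat{\mathbb{G}}\succeq\mathbb{G}$ such that $\hat{\mathbb{G}}$ is $N$-acyclic and such that every permutation $\rho\in\mathrm{Sym}(E)$ that is a symmetry of $\mathbb{G}$ is also a symmetry of $\hat{\mathbb{G}}$.
   Context: Let $E$ be a finite set. An $E$-group is a group $\mathbb{G}$ together with an inclusion $E\subseteq\mathbb{G}$ such that $E$ generates $\mathbb{G}$ and every $e\in E$ satisfies $e\neq 1$ and $e^2=1$. For a word $w=e_1\cdots e_n\in E^*$ write $[w]_{\mathbb{G}}=e_1\cdots e_n\in\mathbb{G}$. A homomorphism of $E$-groups is a group homomorphism mapping each $e\in E$ to $e$; we write $\hat{\mathbb{G}}\succeq\mathbb{G}$ if there is a homomorphism of $E$-groups from $\hat{\mathbb{G}}$ to $\mathbb{G}$. For $\alpha\subseteq E$, $\mathbb{G}[\alpha]$ denotes the subgroup generated by $\alpha$. A coset cycle of length $n\ge 2$ in $\mathbb{G}$ is a cyclically indexed family $(g_i,\alpha_i)_{i\in\mathbb{Z}_n}$ with $g_i\in\mathbb{G}$, $\alpha_i\subseteq E$, such that for all $i\in\mathbb{Z}_n$: (connectivity) $g_{i+1}\in g_i\mathbb{G}[\alpha_i]$; (separation) $g_i\mathbb{G}[\alpha_i\cap\alpha_{i-1}]\cap g_{i+1}\mathbb{G}[\alpha_i\cap\alpha_{i+1}]=\emptyset$. For $N\ge2$, $\mathbb{G}$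 is $N$-acyclic if it admits no coset cycle of length $n$ with $2\le n\le N$. A permutation $\rho\in\mathrm{Sym}(E)$ is a symmetry of the $E$-group $\mathbb{G}$ if there is a group automorphism $\varphi$ of $\mathbb{G}$ with $\varphi(e)=\rho(e)$ for all $e\in E$. *)

(* Defs.v *)
From mathcomp Require Import all_boot all_fingroup.
Set Implicit Arguments. Unset Strict Implicit. Unset Printing Implicit Defensive.
Local Open Scope group_scope.

Definition is_Egroup (E : finType) (gT : finGroupType) (emb : E -> gT) : Prop :=
  [/\ injective emb,
      <<[set emb e | e in E]>> = [set: gT] &
      forall e, emb e != 1 /\ emb e ^+ 2 = 1].

Definition subEgroup (E : finType) (gT : finGroupType) (emb : E -> gT)
  (alpha : {set E}) : {set gT} := <<[set emb e | e in alpha]>>.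

Definition Ehom (E : finType) (hT gT : finGroupType) (f : E -> hT) (emb : E -> gT)
  (phi : hT -> gT) : Prop :=
  {morph phi : x y / x * y} /\ forall e, phi (f e) = emb e.

Definition Egeq (E : finType) (hT gT : finGroupType) (f : E -> hT) (emb : E -> gT) : Prop :=
  exists phi : hT -> gT, Ehom f emb phi.

(* Coset cycle of length n, indexed cyclically by 'I_n (succ = ordS, pred = ord_pred). *)
Definition coset_cycle (E : finType) (gT : finGroupType) (emb : E -> gT) (n : nat)
  (g : 'I_n -> gT) (alpha : 'I_n -> {set E}) : Prop :=
  2 <= n /\
  forall i : 'I_n,
    g (ordS i) \in g i *: subEgroup emb (alpha i) /\
    [disjoint g i *: subEgroup emb (alpha i :&: alpha (ord_pred i))
      & g (ordS i) *: subEgroup emb (alpha i :&: alpha (ordS i))].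

Definition N_acyclic (E : finType) (gT : finGroupType) (emb : E -> gT) (N : nat) : Prop :=
  forall n, 2 <= n <= N ->
    forall (g : 'I_n -> gT) (alpha : 'I_n -> {set E}), ~ coset_cycle emb g alpha.

Definition Esymmetry (E : finType) (gT : finGroupType) (emb : E -> gT) (rho : {perm E}) : Prop :=
  exists phi : gT -> gT,
    [/\ bijective phi, {morph phi : x y / x * y} & forall e, phi (emb e) = emb (rho e)].

(* Main.v *)
(* Words over E act on a product of Cayley graphs with some generators suppressed; the
   resulting group is closed under deletion of generators from relations, so that each
   G[b] is a retract.  Consequently G[a] :&: G[b] = G[a :&: b], and three pairwise
   meeting cosets have a common point.

   A chain over G is a sequence of cosets C_j of subgroups G[a_j], consecutive ones
   meeting and C_(j-1), C_j, C_(j+1) having no common point.  Gluing consecutive Cayley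
   graphs along their intersections gives a graph on which each generator acts as an
   involution, and the group T(G) generated by the action on all chains covers G.  If
   G[b] acts on all chains over G whenever #|b| <= k, then T(G) has the same property
   for k + 1, because the b-component of a chain is a chain for the sets a_j :&: b.  After
   #|E| iterations every relation of the group acts trivially on all chains.  A coset
   cycle of length n >= 3 would give a relation leading from the first copy of a chain
   to the last one; n = 2 is excluded by G[a] :&: G[b] = G[a :&: b]. *)

Require Import Defs.
From mathcomp Require Import all_boot all_fingroup.
Set Implicit Arguments. Unset Strict Implicit. Unset Printing Implicit Defensive.
Local Open Scope group_scope.

(** * E-groups and relations *)

Section Words.

Variable E : finType.
Implicit Types (w : seq E) (e : E) (a b : {set E}).

Definition ev (gT : finGroupType) (emb : E -> gT) w : gT := \prod_(e <- w) emb e.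

Definition del b w := [seq e <- w | e \in b].

Lemma ev_nil (gT : finGroupType) (emb : E -> gT) : ev emb [::] = 1.
Proof. by rewrite /ev big_nil. Qed.

Lemma ev_cons (gT : finGroupType) (emb : E -> gT) e w :
  ev emb (e :: w) = emb e * ev emb w.
Proof. by rewrite /ev big_cons. Qed.

Lemma ev_cat (gT : finGroupType) (emb : E -> gT) w1 w2 :
  ev emb (w1 ++ w2) = ev emb w1 * ev emb w2.
Proof. by rewrite /ev big_cat. Qed.

Lemma ev_map (gT : finGroupType) (emb : E -> gT) (s : E -> E) w :
  ev emb (map s w) = ev (emb \o s) w.
Proof. by rewrite /ev big_map. Qed.

Lemma mem_subEgroupP (gT : finGroupType) (emb : E -> gT) a x :
  reflect (exists2 w, all (mem a) w & x = ev emb w) (x \in subEgroup emb a).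
Proof.
apply: (iffP idP) => [/gen_prodgP[n [c cA ->]] | [w aw ->]].
  elim: n c cA => [|n IHn] c cA; first by exists [::]; rewrite ?big_ord0 ?ev_nil.
  have [|w aw Ew] := IHn (fun i => c (lift ord0 i)); first by move=> i; apply: cA.
  have /imsetP[e ae ce] := cA ord0.
  by exists (e :: w); rewrite /= ?ae // big_ord_recl ev_cons ce Ew.
elim: w aw => [|e w IHw] /=; first by rewrite ev_nil group1.
by case/andP=> ae aw; rewrite ev_cons groupM ?IHw ?mem_gen ?imset_f.
Qed.

Canonical subEgroup_group (gT : finGroupType) (emb : E -> gT) a :=
  Eval hnf in [group of subEgroup emb a].

Lemma subEgroupS (gT : finGroupType) (emb : E -> gT) a b :
  a \subset b -> subEgroup emb a \subset subEgroup emb b.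
Proof. by move=> ab; apply/genS/imsetS. Qed.

Lemma mem_subEgroup (gT : finGroupType) (emb : E -> gT) a e :
  e \in a -> emb e \in subEgroup emb a.
Proof. by move=> ae; rewrite mem_gen ?imset_f. Qed.

Lemma lcoset_subEgroup_gen (gT : finGroupType) (emb : E -> gT) a x y e :
  e \in a -> x \in y *: subEgroup emb a -> x * emb e \in y *: subEgroup emb a.
Proof.
by move=> ae; rewrite !mem_lcoset mulgA => yx; rewrite groupM ?mem_subEgroup.
Qed.

(** What the permutation groups below have by construction; injectivity and [emb e != 1] are
    inherited from the group they cover. *)
Definition generating (gT : finGroupType) (emb : E -> gT) :=
  <<[set emb e | e in E]>> = [set: gT].

Definition involutory (gT : finGroupType) (emb : E -> gT) :=
  forall e, emb e ^+ 2 = 1.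

Lemma subEgroupT (gT : finGroupType) (emb : E -> gT) :
  subEgroup emb [set: E] = <<[set emb e | e in E]>>.
Proof.
rewrite /subEgroup; congr generated; apply/setP=> x.
by apply/idP/idP=> /imsetP[e _ ->]; apply: imset_f; rewrite ?inE.
Qed.

Lemma ev_surj (gT : finGroupType) (emb : E -> gT) :
  generating emb -> forall x, exists w, ev emb w == x.
Proof.
move=> gen x; have: x \in subEgroup emb [set: E].
  by rewrite subEgroupT gen inE.
by case/mem_subEgroupP=> w _ ->; exists w.
Qed.

Lemma generating_words (gT : finGroupType) (emb : E -> gT) :
  (forall x, exists w, ev emb w = x) -> generating emb.
Proof.
move=> surj; apply/setP=> x; rewrite inE; have [w <-] := surj x.
elim: w => [|e w IHw]; first by rewrite ev_nil group1.
by rewrite ev_cons groupM // mem_gen ?imset_f.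
Qed.

Lemma ev_rev (gT : finGroupType) (emb : E -> gT) w :
  involutory emb -> ev emb (rev w) = (ev emb w)^-1.
Proof.
move=> inv; elim: w => [|e w IHw]; first by rewrite ev_nil invg1.
rewrite rev_cons -cats1 ev_cat !ev_cons ev_nil mulg1 IHw invMg.
by congr (_ * _); apply/esym/eqP; rewrite eq_invg_mul -expg2 inv.
Qed.

Lemma ev_hom (hT gT : finGroupType) (f : E -> hT) (emb : E -> gT) phi :
  Ehom f emb phi -> forall w, phi (ev f w) = ev emb w.
Proof.
case=> phiM phif; elim=> [|e w IHw]; last by rewrite !ev_cons phiM phif IHw.
by rewrite !ev_nil; apply: (mulgI (phi 1)); rewrite -phiM !mulg1.
Qed.

(** Generators are involutions, so two words agree in value exactly when [w1 ++ rev w2] is a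
    relation. Needed for [h] the identity and for [h] a deletion. *)
Lemma ev_eq_transfer (hT gT : finGroupType) (f : E -> hT) (emb : E -> gT)
    (h : seq E -> seq E) :
  involutory f -> involutory emb -> {morph h : w1 w2 / w1 ++ w2} ->
  (forall w, h (rev w) = rev (h w)) ->
  (forall w, ev f w = 1 -> ev emb (h w) = 1) ->
  forall w1 w2, ev f w1 = ev f w2 -> ev emb (h w1) = ev emb (h w2).
Proof.
move=> invf inv hM hrev K w1 w2 E12; apply/eqP; rewrite eq_mulgV1.
by rewrite -ev_rev // -hrev -ev_cat -hM K // ev_cat E12 ev_rev // mulgV.
Qed.

Lemma Egeq_rel (hT gT : finGroupType) (f : E -> hT) (emb : E -> gT) :
  generating f -> involutory f -> involutory emb ->
  (forall w, ev f w = 1 -> ev emb w = 1) -> Egeq f emb.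
Proof.
move=> genf invf inv K.
have K2 := ev_eq_transfer (h := id) invf inv (fun _ _ => erefl) (fun _ => erefl) K.
pose wd x := xchoose (ev_surj genf x).
have wdK x : ev f (wd x) = x by apply/eqP/(xchooseP (ev_surj genf x)).
exists (fun x => ev emb (wd x)); split=> [x y | e].
  by rewrite -ev_cat; apply: K2; rewrite ev_cat !wdK.
by rewrite (K2 _ [:: e]) ?wdK !ev_cons !ev_nil !mulg1.
Qed.

Lemma is_Egroup_Egeq (hT gT : finGroupType) (f : E -> hT) (emb : E -> gT) :
  generating f -> involutory f -> is_Egroup emb -> Egeq f emb -> is_Egroup f.
Proof.
move=> genf invf [inj _ nt] [phi phiH]; case: (phiH) => phiM phif.
split=> // [e1 e2 E12 | e]; first by apply: inj; rewrite -!phif E12.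
split; last exact: invf.
apply/eqP=> fe1; have [/eqP[]] := nt e.
by rewrite -phif fe1 -(ev_nil f) (ev_hom phiH) ev_nil.
Qed.

Lemma Esymmetry_rel (gT : finGroupType) (f : E -> gT) (rho : {perm E}) :
  generating f -> involutory f ->
  (forall w, ev f w = 1 -> ev f (map rho w) = 1) -> Esymmetry f rho.
Proof.
move=> genf invf K.
have [|phi phiH] := @Egeq_rel _ _ f (f \o rho) genf invf (fun e => invf (rho e)).
  by move=> w /K; rewrite ev_map.
case: (phiH) => phiM phif; exists phi; split=> //.
(* A surjective endomorphism of a finite group is bijective; [map rho^-1 w] supplies the
   preimages. *)
apply: injF_bij; suff inj: {in setT &, injective phi} by move=> x y; apply: inj.
apply/imset_injP/eqP; congr #|pred_of_set _|; apply/setP=> x; rewrite inE.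
have [w /eqP <-] := ev_surj genf x; apply/imsetP.
exists (ev f (map rho^-1 w)); rewrite ?inE // (ev_hom phiH) -ev_map -map_comp.
by rewrite map_id_in // => e _ /=; rewrite permKV.
Qed.

Lemma Esymmetry_ev (gT : finGroupType) (emb : E -> gT) (rho : {perm E}) w :
  Esymmetry emb rho -> ev emb w = 1 -> ev emb (map rho w) = 1.
Proof.
case=> phi [_ phiM phie] Kw; have phiH: Ehom emb (emb \o rho) phi by split.
by rewrite ev_map -(ev_hom phiH) Kw -(ev_nil emb) (ev_hom phiH) !ev_nil.
Qed.

(** The source of all finite groups constructed here: the group generated by the involutions [pi e]
    of [V], words acting from left to right. *)
Lemma permutation_Egroup (V : finType) (pi : E -> V -> V) :
  (forall e, involutive (pi e)) ->
  exists (hT : finGroupType) (f : E -> hT),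
    [/\ generating f, involutory f &
        forall w, ev f w = 1 <-> forall v, foldl (fun u e => pi e u) v w = v].
Proof.
move=> inv; pose p e := perm (can_inj (inv e)).
pose K := [group of <<[set p e | e in E]>>].
have Kp e : p e \in K by rewrite mem_gen ?imset_f.
pose f e := subg K (p e).
have evf w : sgval (ev f w) = ev p w.
  elim: w => [|e w IHw]; first by rewrite !ev_nil.
  by rewrite !ev_cons /= IHw subgK.
have evp w v : ev p w v = foldl (fun u e => pi e u) v w.
  elim: w v => [|e w IHw] v; first by rewrite ev_nil perm1.
  by rewrite ev_cons permM IHw permE.
exists (subg_of K), f; split=> [|e|w].
- apply: generating_words => x.
  have: sgval x \in subEgroup p [set: E] by rewrite subEgroupT; apply: subgP.
  by case/mem_subEgroupP=> w _ xw; exists w; apply: val_inj; rewrite /= evf.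
- apply: val_inj; rewrite /= subgK //; apply/permP=> v.
  by rewrite permM !permE inv.
split=> [Kw v | Kw].
  by rewrite -evp -evf Kw perm1.
by apply: val_inj; rewrite /= evf; apply/permP=> v; rewrite evp Kw perm1.
Qed.

End Words.

(** * Deletion of generators *)

Section Deletion.

Variables (E : finType) (gT : finGroupType) (emb : E -> gT).
Implicit Types (w : seq E) (a b c : {set E}).

Definition deletion_closed := forall b w, ev emb w = 1 -> ev emb (del b w) = 1.

Hypotheses (inv : involutory emb) (delK : deletion_closed).

Lemma del_id b w : all (mem b) w -> del b w = w.
Proof. by move=> bw; apply/all_filterP. Qed.

Lemma all_del a b w : all (mem a) w -> all (mem (a :&: b)) (del b w).
Proof.
move=> /allP aw; apply/allP=> e; rewrite mem_filter !inE => /andP[-> /aw /=].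
by rewrite andbT.
Qed.

Lemma ev_del_eq b w1 w2 :
  ev emb w1 = ev emb w2 -> ev emb (del b w1) = ev emb (del b w2).
Proof.
apply: (ev_eq_transfer (h := del b)) => //.
- by move=> v1 v2; rewrite /del filter_cat.
- by move=> v; rewrite /del filter_rev.
exact: delK.
Qed.

(** For an element given by an [a]-word and by a [b]-word, [del b] fixes the [b]-word and makes the
    [a]-word a word over [a :&: b] of the same value. *)
Lemma subEgroupI a b :
  subEgroup emb (a :&: b) = subEgroup emb a :&: subEgroup emb b.
Proof.
apply/eqP; rewrite eqEsubset subsetI !subEgroupS ?subsetIl ?subsetIr //=.
apply/subsetP=> x /setIP[/mem_subEgroupP[wa awa ->] /mem_subEgroupP[wb bwb Ewab]].
rewrite Ewab -(del_id bwb) -(ev_del_eq b Ewab); apply/mem_subEgroupP.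
by exists (del b wa) => //; apply: all_del.
Qed.

(* Deleting the letters outside a from a c-word for u^-1 v fixes u and pushes v into
   G[a :&: b]. *)
Lemma subEgroup_helly a b c u v :
  u \in subEgroup emb a -> v \in subEgroup emb b -> u^-1 * v \in subEgroup emb c ->
  exists2 t, t \in subEgroup emb (a :&: b) & u^-1 * t \in subEgroup emb c.
Proof.
move=> /mem_subEgroupP[wa awa ->] /mem_subEgroupP[wb bwb ->] /mem_subEgroupP[wc cwc].
rewrite -ev_rev // -ev_cat => /(ev_del_eq a).
rewrite {1}/del filter_cat filter_rev -!/(del _ _) (del_id awa) ev_cat => Ewc.
exists (ev emb (del a wb)).
  by apply/mem_subEgroupP; exists (del a wb); rewrite // setIC all_del.
rewrite Ewc; apply: (subsetP (subEgroupS _ (subsetIl c a))).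
by apply/mem_subEgroupP; exists (del a wc) => //; apply: all_del.
Qed.

End Deletion.

(** * Chains of cosets *)

Section Chains.

Variables (E I : finType) (adj : rel I).
Hypotheses (adjxx : reflexive adj) (adjC : symmetric adj).

(** * Glued Cayley graphs along a chain *)

Section OneChain.

Variables (gT : finGroupType) (emb : E -> gT).
Implicit Types (S : {ffun I -> {set gT}}) (al : {ffun I -> {set E}}).
Implicit Types (x y : gT) (i j l : I) (e : E) (w : seq E).

(** [S j] may be empty, so that shorter and truncated chains use the same index set [I]. *)
Definition coset_family S al :=
  [forall j, forall x in S j, S j == x *: subEgroup emb (al j)].

Definition tied S :=
  [forall j, forall l, [&& adj j l, S j != set0 & S l != set0] ==>
     (S j :&: S l != set0)].

(** Adjacency is transitive on the copies of a single [x], which makes gluing an equivalence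
    relation. When [adj] is a path with loops, this says that three consecutive cosets have no
    common point. *)
Definition separated S :=
  [forall x, forall i, forall j, forall l,
     [&& x \in S i, x \in S j, x \in S l, adj i j & adj j l] ==> adj i l].

Definition chain S al := [&& coset_family S al, tied S & separated S].

(* Copies j and l of x are glued together when j and l are adjacent, so a vertex
   of the glued graph is x together with the set of its copies. *)
Definition cls S x j := [set l | adj j l & x \in S l].

Definition vtx S x j := (cls S x j, x).

(** A letter carried by no copy of the point acts as a loop. *)
Definition step S al e (v : {set I} * gT) :=
  if [pick l in v.1 | e \in al l] is Some l then vtx S (v.2 * emb e) l else v.

Definition run S al w v := foldl (fun u e => step S al e u) v w.

Definition inert S al w := forall j x, x \in S j -> run S al w (vtx S x j) = vtx S x j.

Definition stable S al := forall j x e, x \in S j -> e \in al j -> x * emb e \in S j.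

Lemma coset_familyP S al j x :
  coset_family S al -> x \in S j -> S j = x *: subEgroup emb (al j).
Proof. by move=> /forallP/(_ j)/forall_inP + xS => /(_ x xS)/eqP. Qed.

Lemma tiedP S j l x y :
  tied S -> adj j l -> x \in S j -> y \in S l -> exists2 z, z \in S j & z \in S l.
Proof.
move=> /forallP/(_ j)/forallP/(_ l) tS jl xj yl; move: tS.
have -> : S j != set0 by apply/set0Pn; exists x.
have -> : S l != set0 by apply/set0Pn; exists y.
by rewrite jl /= => /set0Pn[z /setIP[]]; exists z.
Qed.

Lemma separatedP S x i j l :
  separated S -> x \in S i -> x \in S j -> x \in S l -> adj i j -> adj j l -> adj i l.
Proof.
move=> /forallP/(_ x)/forallP/(_ i)/forallP/(_ j)/forallP/(_ l).
by move=> + xi xj xl ij jl; rewrite xi xj xl ij jl.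
Qed.

Lemma coset_family_stable S al : coset_family S al -> stable S al.
Proof.
move=> cS j x e xS ae; rewrite (coset_familyP cS xS).
by apply: lcoset_subEgroup_gen ae _; apply: lcoset_refl.
Qed.

Lemma cls_eq S x j l :
  separated S -> x \in S j -> l \in cls S x j -> cls S x l = cls S x j.
Proof.
move=> sS xj; rewrite inE => /andP[jl xl]; apply/setP=> i; rewrite !inE.
case xi: (x \in S i); rewrite ?andbF ?andbT //; apply/idP/idP => h.
  exact: (separatedP sS xj xl xi).
by rewrite adjC in jl; apply: (separatedP sS xl xj xi).
Qed.

Lemma vtx_eq S x j l :
  separated S -> x \in S j -> l \in cls S x j -> vtx S x l = vtx S x j.
Proof. by move=> sS xj jl; rewrite /vtx (cls_eq sS xj jl). Qed.

Lemma mem_cls S x j : x \in S j -> j \in cls S x j.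
Proof. by rewrite inE adjxx. Qed.

(** [pick] may return another copy [i] with [e \in al i]; then [x * emb e] lies in both cosets, and
    [i] and [l] are adjacent by separation, so the two results are the same vertex. *)
Lemma step_in S al x j l e : separated S -> stable S al ->
  x \in S j -> l \in cls S x j -> e \in al l ->
  step S al e (vtx S x j) = vtx S (x * emb e) l.
Proof.
move=> sS stS xj jl el; rewrite /step /=; case: pickP => [i|/(_ l)]; last by rewrite jl el.
case/andP=> ji ei; have [xi xl] : x \in S i /\ x \in S l.
  by move: ji jl; rewrite !inE => /andP[_ ->] /andP[_ ->].
apply: vtx_eq => //; first exact: stS.
by rewrite inE stS // andbT; move: ji; rewrite -(cls_eq sS xj jl) inE; case/andP.
Qed.

Lemma step_out S al x j e : (forall l, l \in cls S x j -> e \notin al l) ->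
  step S al e (vtx S x j) = vtx S x j.
Proof.
by move=> out; rewrite /step /=; case: pickP => // l /andP[/out/negPf->].
Qed.

Lemma run_in S al w x j : separated S -> stable S al ->
  x \in S j -> all (mem (al j)) w ->
  x * ev emb w \in S j /\ run S al w (vtx S x j) = vtx S (x * ev emb w) j.
Proof.
move=> sS stS; elim: w x => [|e w IHw] x xj /=; first by rewrite ev_nil mulg1.
case/andP=> ae aw; rewrite (step_in (l := j)) ?mem_cls // ev_cons mulgA.
by apply: IHw => //; apply: stS.
Qed.

End OneChain.

(** Shared engine of [inert_del], [tameS] and [inert_symmetry]. On the pairs in [P] the second graph
    looks like the first with all letters outside [b] turned into loops, so [w] there follows
    [del b w] here. *)
Lemma run_simulation (hT gT : finGroupType) (f : E -> hT) (emb : E -> gT)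
    (S : {ffun I -> {set hT}}) (al : {ffun I -> {set E}})
    (S' : {ffun I -> {set gT}}) (al' : {ffun I -> {set E}})
    (phi : hT -> gT) (b : {set E}) (P : I -> pred hT) :
  separated S -> stable f S al -> separated S' -> stable emb S' al' ->
  (forall x e, phi (x * f e) = phi x * emb e) ->
  (forall j x, P j x -> x \in S j /\ phi x \in S' j) ->
  (forall j x, P j x -> cls S x j = cls S' (phi x) j) ->
  (forall j x l, P j x -> l \in cls S x j -> P l x) ->
  (forall j x e, P j x -> e \in b -> e \in al j -> P j (x * f e)) ->
  (forall j x e, P j x -> (e \in al' j) = (e \in b) && (e \in al j)) ->
  forall w j x, P j x -> exists l y,
    [/\ P l y, run f S al (del b w) (vtx S x j) = vtx S y l
      & run emb S' al' w (vtx S' (phi x) j) = vtx S' (phi y) l].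
Proof.
move=> sS stS sS' stS' phiM PS Pcls Pl Pe Pal.
elim=> [|e w IHw] j x Pjx /=; first by exists j, x.
have [xS xS'] := PS _ _ Pjx; have Ecls := Pcls _ _ Pjx.
have [/exists_inP[l jl /andP[be ale]] | out] :=
  boolP [exists l in cls S x j, (e \in b) && (e \in al l)].
  have Plx := Pl _ _ _ Pjx jl; have Plxe := Pe _ _ _ Plx be ale.
  have [i [y [Piy Ry R'y]]] := IHw _ _ Plxe; exists i, y; split=> //.
    by rewrite be /= (step_in (l := l)).
  by rewrite (step_in (l := l)) -?Ecls -?phiM // (Pal _ _ _ Plx) be ale.
have [i [y [Piy Ry R'y]]] := IHw _ _ Pjx; exists i, y; split=> //.
  case: ifPn => // be; rewrite /= step_out // => l jl.
  by apply: contra out => ale; apply/exists_inP; exists l; rewrite ?be.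
rewrite step_out // -Ecls => l jl; rewrite (Pal _ _ _ (Pl _ _ _ Pjx jl)).
by apply: contra out => bale; apply/exists_inP; exists l.
Qed.

Lemma chain_Egroup (gT : finGroupType) (emb : E -> gT) :
  involutory emb ->
  exists (hT : finGroupType) (f : E -> hT),
    [/\ generating f, involutory f & forall w, ev f w = 1 <->
          forall S al, chain emb S al -> inert emb S al w].
Proof.
move=> inv; pose D := ({ffun I -> {set gT}} * {ffun I -> {set E}})%type.
pose good (c : D) (u : {set I} * gT) :=
  chain emb c.1 c.2 && [exists j, (u.2 \in c.1 j) && (u == vtx c.1 u.2 j)].
pose st e (c : D) u := step emb c.1 c.2 e u.
have stP e c u : good c u -> good c (st e c u) /\ st e c (st e c u) = u.
  case: c u => S al [L x] /andP[/= chS /existsP[j /= /andP[xj /eqP->]]].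
  have /and3P[cS tS sS] := chS; have stS := coset_family_stable cS.
  rewrite /good /st /= chS.
  have [/exists_inP[l jl el] | out] := boolP [exists l in cls S x j, e \in al l].
    have xl : x \in S l by move: jl; rewrite inE => /andP[].
    have xel := stS _ _ _ xl el.
    rewrite (step_in sS stS xj jl el); split.
      by apply/existsP; exists l; rewrite /= xel eqxx.
    rewrite (step_in (l := l)) ?mem_cls // -mulgA -expg2 inv mulg1.
    exact: vtx_eq.
  have {}out l : l \in cls S x j -> e \notin al l.
    by move=> jl; apply: contra out => el; apply/exists_inP; exists l.
  by rewrite !step_out //; split=> //; apply/existsP; exists j; rewrite /= xj eqxx.
(* Pairs that are not a vertex of a chain are fixed, so they impose no condition on relations. *)
pose pi e (v : D * ({set I} * gT)) := if good v.1 v.2 then (v.1, st e v.1 v.2) else v.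
have piK e : involutive (pi e).
  case=> c u; rewrite {2}/pi /=; case: ifP => [gu | ngu]; last by rewrite /pi /= ngu.
  by rewrite /pi /=; case: (stP e c u gu) => -> ->.
have foldl_pi w c u : good c u ->
    foldl (fun u e => pi e u) (c, u) w = (c, run emb c.1 c.2 w u).
  elim: w u => [|e w IHw] u gu //=.
  by rewrite {2}/pi /= gu IHw //; case: (stP e c u gu).
have [hT [f [genf invf Kf]]] := permutation_Egroup piK.
exists hT, f; split=> // w; split=> [/Kf Kw S al chS j x xj | Kw].
  have /(foldl_pi w) : good (S, al) (vtx S x j).
    by rewrite /good chS; apply/existsP; exists j; rewrite /= xj eqxx.
  by rewrite Kw => -[].
apply/Kf=> -[c u]; case: (boolP (good c u)) => [gu | ngu].
  rewrite foldl_pi //; case/andP: gu => chS /existsP[j /andP[xj /eqP->]].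
  by rewrite (Kw _ _ chS).
by elim: w {Kw} => //= e w IHw; rewrite {2}/pi /= (negPf ngu).
Qed.

(** * Cutting a chain down to a coset of G[b] *)

Section Restriction.

Variables (gT : finGroupType) (emb : E -> gT).
Hypotheses (inv : involutory emb) (delK : deletion_closed emb).
Variables (S : {ffun I -> {set gT}}) (al : {ffun I -> {set E}}).
Hypothesis chS : chain emb S al.

(** Adjacent cosets that meet [x *: subEgroup emb b] also meet each other inside it, by the Helly
    property. Emptying the copies in [drop] serves [tameS]. *)
Lemma chain_restrict (x : gT) (b : {set E}) (drop : pred I) :
  chain emb [ffun l => if drop l then set0 else S l :&: x *: subEgroup emb b]
    [ffun l => al l :&: b].
Proof.
have /and3P[cS tS sS] := chS; set B := x *: _.
have inB y : y \in B -> B = y *: subEgroup emb b by move=> /lcoset_eqP.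
apply/and3P; split.
- apply/forallP=> l; apply/forall_inP=> y; rewrite !ffunE.
  case: (drop l); first by rewrite inE.
  case/setIP=> yl yB; rewrite (coset_familyP cS yl) (inB y yB) subEgroupI //.
  by apply/eqP/setP=> z; rewrite !(inE, mem_lcoset).
- apply/forallP=> i; apply/forallP=> l; apply/implyP=> /and3P[il]; rewrite !ffunE.
  case: (drop i); first by rewrite eqxx.
  case: (drop l); first by rewrite eqxx.
  case/set0Pn=> p /setIP[pi pB] /set0Pn[q /setIP[ql qB]].
  (* Translating by a common point [z] turns both cosets into subgroups, as [subEgroup_helly]
     requires. *)
  have [z zi zl] := tiedP tS il pi ql.
  have ui : z^-1 * p \in subEgroup emb (al i).
    by rewrite -mem_lcoset -(coset_familyP cS zi).
  have vl : z^-1 * q \in subEgroup emb (al l).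
    by rewrite -mem_lcoset -(coset_familyP cS zl).
  have pq : (z^-1 * p)^-1 * (z^-1 * q) \in subEgroup emb b.
    by rewrite invMg invgK mulgA mulgK -mem_lcoset -inB.
  have [t tI tb] := subEgroup_helly inv delK ui vl pq.
  apply/set0Pn; exists (z * t); move: tI; rewrite subEgroupI // => /setIP[ti tl].
  have ztB : z * t \in B.
    by rewrite (inB p pB) mem_lcoset mulgA; rewrite invMg invgK in tb.
  rewrite !in_setI ztB (coset_familyP cS zi) (coset_familyP cS zl).
  by rewrite !mem_lcoset !mulKg ti tl.
apply/forallP=> y; apply/forallP=> i; apply/forallP=> j; apply/forallP=> l.
apply/implyP=> /and5P[]; rewrite !ffunE.
case: (drop i); first by rewrite inE.
case: (drop j); first by rewrite !inE.
case: (drop l); first by rewrite !inE.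
by move=> /setIP[yi _] /setIP[yj _] /setIP[yl _]; apply: separatedP sS yi yj yl.
Qed.

(** A [b]-word started at [x] stays in [x *: subEgroup emb b]. On the chain cut down to that coset,
    letters outside [b] are loops, so [w] acts there as [del b w] does on [S]. *)
Lemma inert_del b w :
  (forall S al, chain emb S al -> inert emb S al w) -> inert emb S al (del b w).
Proof.
move=> Kw j x xj; have chS' := chain_restrict x b pred0.
move: chS' (Kw _ _ chS'); set S' := [ffun=> _]; set al' := [ffun=> _] => chS' inS'.
have /and3P[cS tS sS] := chS; have /and3P[cS' tS' sS'] := chS'.
have S'E l y : (y \in S' l) = (y \in S l) && (y \in x *: subEgroup emb b).
  by rewrite ffunE inE.
have xj' : x \in S' j by rewrite S'E xj lcoset_refl.
have clsE y l : y \in S' l -> cls S y l = cls S' y l.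
  by rewrite S'E => /andP[_ yB]; apply/setP=> i; rewrite !inE S'E yB andbT.
have [||||||l [y [yl Ry R'y]]] := @run_simulation _ _ emb emb S al S' al' id b
  (fun l y => y \in S' l) sS (coset_family_stable cS) sS' (coset_family_stable cS')
  _ _ _ _ _ _ w j x xj'.
- by [].
- by move=> l y yl; split=> //; move: yl; rewrite S'E => /andP[].
- by move=> l y; exact: clsE.
- by move=> l y i /clsE->; rewrite inE => /andP[].
- move=> l y e; rewrite !S'E => /andP[yl yB] be ale.
  by rewrite (coset_family_stable cS) // lcoset_subEgroup_gen.
- by move=> l y e _; rewrite ffunE inE andbC.
rewrite Ry; move: R'y; rewrite inS' // => -[E1 E2].
by rewrite /vtx -E2 (clsE x j) // E1 clsE // E2.
Qed.

End Restriction.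

(** * Tameness, graded by the number of generators *)

Definition tame (gT : finGroupType) (emb : E -> gT) k :=
  forall (b : {set E}) w, #|b| <= k -> all (mem b) w -> ev emb w = 1 ->
  forall S al, chain emb S al -> inert emb S al w.

Lemma tame0 (gT : finGroupType) (emb : E -> gT) : tame emb 0.
Proof.
move=> b w; rewrite leqn0 cards_eq0 => /eqP->.
by case: w => [|e w] /=; rewrite ?inE.
Qed.

Lemma Ehom_subEgroup (hT gT : finGroupType) (f : E -> hT) (emb : E -> gT) phi a y :
  Ehom f emb phi -> y \in subEgroup emb a ->
  exists2 u, u \in subEgroup f a & phi u = y.
Proof.
move=> phiH /mem_subEgroupP[w aw ->]; exists (ev f w); last exact: ev_hom.
by apply/mem_subEgroupP; exists w.
Qed.

Lemma Ehom_mem (hT gT : finGroupType) (f : E -> hT) (emb : E -> gT) phi a u :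
  Ehom f emb phi -> u \in subEgroup f a -> phi u \in subEgroup emb a.
Proof.
move=> phiH /mem_subEgroupP[w aw ->]; rewrite (ev_hom phiH).
by apply/mem_subEgroupP; exists w.
Qed.

Lemma EhomV (hT gT : finGroupType) (f : E -> hT) (emb : E -> gT) phi x :
  Ehom f emb phi -> phi x^-1 = (phi x)^-1.
Proof.
move=> phiH; have phi1: phi 1 = 1 by rewrite -(ev_nil f) (ev_hom phiH) ev_nil.
by apply: (mulgI (phi x)); case: phiH => phiM _; rewrite -phiM !mulgV.
Qed.

(** * Images of chains under a homomorphism *)

Section Transfer.

Variables (hT gT : finGroupType) (f : E -> hT) (emb : E -> gT) (phi : hT -> gT).
Hypotheses (phiH : Ehom f emb phi).
Hypotheses (inv : involutory emb) (delK : deletion_closed emb).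
Variables (S : {ffun I -> {set hT}}) (al : {ffun I -> {set E}}).
Hypothesis chS : chain f S al.
Hypothesis phi_inj : forall l, {in S l &, injective phi}.

(** For [z] common to both cosets, [phi (z^-1 * x)] lies in the subgroups of [al i] and of [al j],
    hence in that of [al i :&: al j], and lifts to some [u] there. Then [z * u] lies in both cosets
    and equals [x] by injectivity on [S i]. *)
Lemma image_meet i j x y : adj i j -> x \in S i -> y \in S j ->
  phi x = phi y -> x \in S j.
Proof.
move=> ij xi yj Exy; have /and3P[cS tS sS] := chS; have [phiM _] := phiH.
have [z zi zj] := tiedP tS ij xi yj.
have : phi (z^-1 * x) \in subEgroup emb (al i :&: al j).
  rewrite subEgroupI // inE (Ehom_mem phiH) -?mem_lcoset -?(coset_familyP cS zi) //=.
  rewrite phiM Exy -phiM (Ehom_mem phiH) // -mem_lcoset.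
  by rewrite -(coset_familyP cS zj).
case/(Ehom_subEgroup phiH)=> u; move/(subsetP (subEgroupS f _)) => uI Eu.
have ui : z * u \in S i by rewrite (coset_familyP cS zi) mem_lcoset mulKg uI ?subsetIl.
have uj : z * u \in S j by rewrite (coset_familyP cS zj) mem_lcoset mulKg uI ?subsetIr.
by rewrite (phi_inj xi ui) // phiM Eu -phiM mulKVg.
Qed.

Lemma chain_image : chain emb [ffun l => phi @: S l] al.
Proof.
have /and3P[cS tS sS] := chS; have [phiM _] := phiH.
apply/and3P; split.
- apply/forallP=> l; apply/forall_inP=> y; rewrite ffunE => /imsetP[x xl ->].
  rewrite (coset_familyP cS xl); apply/eqP/setP=> y'; rewrite mem_lcoset.
  apply/imsetP/idP=> [[x' + ->] | /(Ehom_subEgroup phiH)[u uE Eu]].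
    by rewrite mem_lcoset => /(Ehom_mem phiH); rewrite phiM (EhomV _ phiH).
  by exists (x * u); rewrite ?mem_lcoset ?mulKg // phiM Eu mulKVg.
- apply/forallP=> i; apply/forallP=> l; apply/implyP=> /and3P[il]; rewrite !ffunE.
  case/set0Pn=> _ /imsetP[x xi _] /set0Pn[_ /imsetP[y yl _]].
  have [z zi zl] := tiedP tS il xi yl.
  by apply/set0Pn; exists (phi z); rewrite inE !imset_f.
apply/forallP=> y; apply/forallP=> i; apply/forallP=> j; apply/forallP=> l.
rewrite !ffunE; apply/implyP.
case/and5P=> /imsetP[xi xiS ->] /imsetP[xj xjS Ej] /imsetP[xl xlS El] ij jl.
have xiSj := image_meet ij xiS xjS Ej.
exact: separatedP sS xiS xiSj (image_meet jl xiSj xlS El) ij jl.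
Qed.

End Transfer.

(* On the b-component of a vertex, either some copy carries the full coset of
   G[b], or all the cosets involved have fewer than #|b| generators and the component is isomorphic to a chain of the smaller group. *)
Lemma tameS (hT gT : finGroupType) (f : E -> hT) (emb : E -> gT) k :
  involutory f -> involutory emb -> deletion_closed f -> deletion_closed emb ->
  Egeq f emb ->
  (forall w, ev f w = 1 <-> forall S al, chain emb S al -> inert emb S al w) ->
  tame emb k -> tame f k.+1.
Proof.
move=> invf inv delf delK [phi phiH] Kf tame_k b w ltbk bw fw1 S al chS j x xj.
have /and3P[cS tS sS] := chS; have stS := coset_family_stable cS.
(* If some copy is closed under all letters of [b], the run stays in it and ends at [x * ev f w],
   which is [x]. *)
have [/exists_inP[l jl bl] | out] := boolP [exists l in cls S x j, b \subset al l].
  have xl : x \in S l by move: jl; rewrite inE => /andP[].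
  rewrite -(vtx_eq sS xj jl); have [|_ ->] := run_in (w := w) sS stS xl.
    by apply: sub_all bw => e; apply: (subsetP bl).
  by rewrite fw1 mulg1.
set B := x *: subEgroup f b.
have inB y : y \in B -> B = y *: subEgroup f b by move=> /lcoset_eqP.
have xB : x \in B by apply: lcoset_refl.
pose full l := (b \subset al l) && (S l :&: B != set0).
have fullB l y : full l -> y \in B -> y \in S l.
  case/andP=> bl /set0Pn[z /setIP[zl zB]]; rewrite (inB z zB) (coset_familyP cS zl).
  by rewrite !mem_lcoset; apply: (subsetP (subEgroupS f bl)).
(* Full copies and their neighbours are removed, leaving proper subsets of [b]. A full coset
   contains [B], so a full neighbour would belong to the class of the current point; by separation
   the run from [x] never meets one. *)
pose drop l := [exists m, adj m l && full m].
have := chain_restrict invf delf chS x b drop; rewrite -/B.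
set S2 := [ffun=> _]; set al2 := [ffun=> _] => chS2.
have S2P l y : reflect [/\ ~~ drop l, y \in S l & y \in B] (y \in S2 l).
  rewrite ffunE; case: (drop l); first by rewrite inE; constructor; case.
  by apply: (iffP setIP); case.
(* A word for [y^-1 * z] over at most [k] generators is a relation of [emb], acts trivially on all
   chains over [emb] by [tame_k], and so is a relation of [f] by [Kf]. *)
have inj2 l : {in S2 l &, injective phi}.
  move=> y z yl zl Eyz; have /and3P[cS2 _ _] := chS2; case: (phiH) => phiM _.
  have : y^-1 * z \in subEgroup f (al2 l) by rewrite -mem_lcoset -(coset_familyP cS2 yl).
  case/mem_subEgroupP=> u au Eu; apply: (mulgI y^-1); rewrite mulVg Eu.
  apply/esym/Kf; apply: (tame_k (al2 l)) => //; last first.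
    by rewrite -(ev_hom phiH) -Eu phiM (EhomV _ phiH) Eyz mulVg.
  have /S2P[ndl ylS yB] := yl; rewrite -ltnS; apply: leq_trans ltbk.
  rewrite ffunE; apply/proper_card; rewrite properE subsetIr subsetI subxx andbT.
  apply: contra ndl => bl; apply/existsP; exists l; rewrite adjxx /full bl.
  by apply/set0Pn; exists y; rewrite inE ylS.
have chS3 := chain_image phiH inv delK chS2 inj2.
move: chS3 (Kf w); set S3 := [ffun=> _] => chS3 [/(_ fw1 _ _ chS3) in3 _].
have /and3P[cS3 tS3 sS3] := chS3; have [phiM phif] := phiH.
have clsE l y : y \in S2 l -> cls S y l = cls S3 (phi y) l.
  move=> yl; have /S2P[ndl ylS yB] := yl; apply/setP=> i; rewrite !inE.
  case li: (adj l i) => //=; rewrite ffunE; apply/idP/imsetP=> [yi | [z zi Eyz]].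
    exists y => //; apply/S2P; split=> //; apply/existsP=> -[m /andP[mi fm]].
    case/existsP: ndl; exists m; rewrite fm andbT.
    by apply: (separatedP sS (fullB _ _ fm yB) yi ylS mi); rewrite adjC.
  by have /S2P[] := image_meet phiH inv delK chS2 inj2 li yl zi Eyz.
have clsS2 l y i : y \in S2 l -> i \in cls S y l -> y \in S2 i.
  move=> yl; rewrite (clsE l y yl) !inE ffunE => /andP[li /imsetP[z zi Eyz]].
  exact: (image_meet phiH inv delK chS2 inj2 li yl zi Eyz).
have xj2 : x \in S2 j.
  apply/S2P; split=> //; apply/existsP=> -[m /andP[mj fm]].
  case/exists_inP: out; exists m; last by case/andP: fm.
  by rewrite inE adjC mj (fullB m x fm).
have [||||||l [y [yl Ry R'y]]] := @run_simulation _ _ f emb S al S3 al2 phi b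
  (fun l y => y \in S2 l) sS stS sS3 (coset_family_stable cS3) _ _ _ _ _ _ w j x xj2.
- by move=> y e; rewrite phiM phif.
- by move=> l y yl; split; [case/S2P: yl | rewrite ffunE imset_f].
- by move=> l y; apply: clsE.
- by move=> l y i; apply: clsS2.
- move=> l y e /S2P[ndl yl yB] be ale; apply/S2P; split=> //; first exact: stS.
  exact: lcoset_subEgroup_gen.
- by move=> l y e _; rewrite ffunE inE andbC.
move: Ry R'y; rewrite (del_id bw) => ->.
rewrite in3 => [[E1 E2]|]; last by rewrite ffunE imset_f.
have Ecls : cls S x j = cls S y l by rewrite !clsE.
(* Equal classes put [y] in the same copy as [x], where [phi] is injective. *)
have yj : y \in S2 j by apply: (clsS2 l) => //; rewrite -Ecls mem_cls.
by rewrite /vtx -Ecls (inj2 j x y xj2 yj E2).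
Qed.

(** Pulling a chain back along the automorphism [phi], and its letter sets along [rho], gives a
    chain on which [w] acts as [map rho w] acts on the original. *)
Lemma inert_symmetry (gT : finGroupType) (emb : E -> gT) (rho : {perm E}) w :
  Esymmetry emb rho -> (forall S al, chain emb S al -> inert emb S al w) ->
  forall S al, chain emb S al -> inert emb S al (map rho w).
Proof.
case=> phi [[psi phiK psiK] phiM phie] Kw S al chS j x xj.
have phiH : Ehom emb (emb \o rho) phi by split.
have psiM : {morph psi : y z / y * z}.
  by move=> y z; apply: (can_inj phiK); rewrite phiM !psiK.
have psie e : psi (emb (rho e)) = emb e by rewrite -phie phiK.
have rhoE b u : (phi u \in subEgroup emb b) = (u \in subEgroup emb (rho @^-1: b)).
  apply/mem_subEgroupP/mem_subEgroupP=> -[v bv Ev].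
    exists (map rho^-1 v).
      by apply/allP=> _ /mapP[e ev ->] /=; rewrite inE permKV; apply: (allP bv).
    apply: (can_inj phiK); rewrite Ev (ev_hom phiH) -ev_map -map_comp.
    by rewrite map_id_in // => e _ /=; rewrite permKV.
  exists (map rho v); last by rewrite Ev (ev_hom phiH) ev_map.
  by apply/allP=> _ /mapP[e ev ->] /=; move: (allP bv e ev); rewrite /= inE.
have /and3P[cS tS sS] := chS; have stS := coset_family_stable cS.
pose S' : {ffun I -> {set gT}} := [ffun l => phi @^-1: S l].
pose al' : {ffun I -> {set E}} := [ffun l => rho @^-1: al l].
have chS' : chain emb S' al'.
  apply/and3P; split.
  - apply/forallP=> l; apply/forall_inP=> y; rewrite !ffunE inE => yl.
    apply/eqP/setP=> z; rewrite inE (coset_familyP cS yl) !mem_lcoset -rhoE phiM.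
    by rewrite (EhomV _ phiH).
  - apply/forallP=> i; apply/forallP=> l; apply/implyP=> /and3P[il]; rewrite !ffunE.
    case/set0Pn=> p; rewrite inE => pi /set0Pn[q]; rewrite inE => ql.
    have [z zi zl] := tiedP tS il pi ql.
    by apply/set0Pn; exists (psi z); rewrite !inE psiK zi.
  apply/forallP=> y; apply/forallP=> i; apply/forallP=> m; apply/forallP=> l.
  by apply/implyP; rewrite !ffunE !inE => /and5P[]; apply: (separatedP sS).
have /and3P[cS' tS' sS'] := chS'.
have runE u v : run emb S al (map rho u) v = run (emb \o rho) S al' u v.
  elim: u v => [|e u IHu] v //=; rewrite IHu; congr (run _ _ _ _ _).
  rewrite /step (eq_pick (Q := fun l => (l \in v.1) && (e \in al' l))) // => l.
  by rewrite /= ffunE inE.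
have clsE y l : cls S y l = cls S' (psi y) l.
  by apply/setP=> i; rewrite !inE ffunE inE psiK.
have [|||||||l [y [yl Ry R'y]]] :=
  @run_simulation _ _ (emb \o rho) emb S al' S' al' psi [set: E] (fun l y => y \in S l)
  sS _ sS' (coset_family_stable cS') _ _ _ _ _ _ w j x xj.
- by move=> l y e yl; rewrite ffunE inE; apply: stS.
- by move=> y e; rewrite psiM /= psie.
- by move=> l y yl; rewrite ffunE inE psiK.
- by [].
- by move=> l y i _; rewrite inE => /andP[].
- by move=> l y e yl _; rewrite ffunE inE; apply: stS.
- by move=> l y e _; rewrite inE.
rewrite runE; move: Ry R'y; rewrite del_id => [->|]; last by apply/allP=> e; rewrite inE.
rewrite (Kw _ _ chS') => [[E1 /(can_inj psiK) E2]|]; last by rewrite ffunE inE psiK.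
by rewrite /vtx !clsE E1 E2.
Qed.

Lemma expansion (gT : finGroupType) (emb : E -> gT) (i0 : I) :
  is_Egroup emb -> deletion_closed emb ->
  exists (hT : finGroupType) (f : E -> hT),
    [/\ is_Egroup f, Egeq f emb, deletion_closed f,
        forall k, tame emb k -> tame f k.+1 &
        forall rho : {perm E}, Esymmetry emb rho -> Esymmetry f rho].
Proof.
move=> HG delK; have inv : involutory emb by case: HG => _ _ nt e; case: (nt e).
have [hT [f [genf invf Kf]]] := chain_Egroup inv.
have delf : deletion_closed f.
  by move=> b w /Kf Kw; apply/Kf => S al chS; apply: inert_del.
have fG : Egeq f emb.
  apply: Egeq_rel => // w /Kf Kw.
  (* A chain with one nonempty coset, the whole group: acting trivially on it forces
     [ev emb w = 1]. *)
  pose S : {ffun I -> {set gT}} := [ffun l => if l == i0 then setT else set0].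
  pose al : {ffun I -> {set E}} := [ffun=> [set: E]].
  have SP l y : y \in S l -> l = i0 by rewrite ffunE; case: eqP; rewrite ?inE.
  have S0 y : y \in S i0 by rewrite ffunE eqxx inE.
  have chS : chain emb S al.
    apply/and3P; split.
    - apply/forallP=> l; apply/forall_inP=> y /SP->; apply/eqP/setP=> z.
      rewrite S0 mem_lcoset ffunE; apply/esym.
      have [v /eqP <-] := ev_surj (let: And3 _ g _ := HG in g) (y^-1 * z).
      by apply/mem_subEgroupP; exists v => //; apply/allP=> e; rewrite inE.
    - apply/forallP=> i; apply/forallP=> l; apply/implyP.
      case/and3P=> _ /set0Pn[y /SP->] /set0Pn[z /SP->].
      by apply/set0Pn; exists 1; rewrite inE S0.
    apply/forallP=> y; apply/forallP=> i; apply/forallP=> j; apply/forallP=> l.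
    by apply/implyP=> /and5P[/SP-> _ /SP-> _ _]; apply: adjxx.
  have /and3P[cS _ sS] := chS.
  have [|_] := run_in (w := w) sS (coset_family_stable cS) (S0 1).
    by apply/allP=> e; rewrite /= ffunE inE.
  by rewrite (Kw _ _ chS) // mul1g => -[_ <-].
exists hT, f; split=> //.
- exact: is_Egroup_Egeq fG.
- by move=> k; apply: tameS.
move=> rho sym; apply: Esymmetry_rel => // w /Kf Kw; apply/Kf.
exact: inert_symmetry.
Qed.

Lemma tame_expansion k (gT : finGroupType) (emb : E -> gT) (i0 : I) :
  is_Egroup emb -> deletion_closed emb ->
  exists (hT : finGroupType) (f : E -> hT),
    [/\ is_Egroup f, Egeq f emb, deletion_closed f, tame f k &
        forall rho : {perm E}, Esymmetry emb rho -> Esymmetry f rho].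
Proof.
move=> HG delK; elim: k => [|k [hT [f [fE [phi [phiM phif]] delf tf symf]]]].
  exists gT, emb; split=> //; last exact: tame0.
  by exists id; split.
have [kT [h [hE [psi [psiM psih]] delh th symh]]] := expansion i0 fE delf.
exists kT, h; split=> //; last by move=> rho /symf/symh.
- exists (phi \o psi); split=> [x y | e] /=; first by rewrite psiM phiM.
  by rewrite psih phif.
exact: th.
Qed.

End Chains.

(** The group acts on one Cayley graph for each [b], letters outside [b] being loops, so its
    relations are the words all of whose deletions are relations. This is stable under further
    deletion, as [del c (del b w)] is [del (c :&: b) w], and under symmetries, which permute the
    sets [b]. *)
Lemma deletion_closed_expansion (E : finType) (gT : finGroupType) (emb : E -> gT) :
  is_Egroup emb ->
  exists (hT : finGroupType) (f : E -> hT),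
    [/\ is_Egroup f, Egeq f emb, deletion_closed f &
        forall rho : {perm E}, Esymmetry emb rho -> Esymmetry f rho].
Proof.
move=> HG; have inv : involutory emb by case: HG => _ _ nt e; case: (nt e).
pose pi e (v : {set E} * gT) := if e \in v.1 then (v.1, v.2 * emb e) else v.
have piK e : involutive (pi e).
  case=> b x; rewrite {2}/pi /=; case: ifP => be; rewrite /pi /= be //.
  by rewrite -mulgA -expg2 inv mulg1.
have [hT [f [genf invf Kf0]]] := permutation_Egroup piK.
have runE w b x : foldl (fun v e => pi e v) (b, x) w = (b, x * ev emb (del b w)).
  elim: w x => [|e w IHw] x /=; first by rewrite ev_nil mulg1.
  by rewrite {2}/pi /=; case: ifP; rewrite IHw // ev_cons mulgA.
have Kf w : ev f w = 1 <-> forall b, ev emb (del b w) = 1.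
  split=> [/Kf0 Kw b | Kw]; last by apply/Kf0 => -[b x]; rewrite runE Kw mulg1.
  by have := Kw (b, 1); rewrite runE mul1g => -[].
have fG : Egeq f emb.
  apply: Egeq_rel => // w /Kf/(_ [set: E]); rewrite del_id //.
  by apply/allP=> e; rewrite inE.
exists hT, f; split=> //; first exact: is_Egroup_Egeq fG.
  move=> b w /Kf Kw; apply/Kf => c; rewrite -(Kw (c :&: b)) /del -filter_predI.
  by congr (ev _ _); apply: eq_filter => e; rewrite /= inE.
move=> rho sym; apply: Esymmetry_rel => // w /Kf Kw; apply/Kf => b.
rewrite -(Esymmetry_ev sym (Kw (rho @^-1: b))) /del filter_map.
by congr (ev _ (map _ _)); apply: eq_filter => e; rewrite /= inE.
Qed.

(** * Coset cycles *)

(** A path with loops, not a cycle: the coset cycle is cut open between its last and first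
    cosets. *)
Definition near N : rel 'I_N := fun i j => (i <= j.+1) && (j <= i.+1).

Lemma tame_acyclic (E : finType) (gT : finGroupType) (emb : E -> gT) N :
  is_Egroup emb -> deletion_closed emb -> tame (@near N) emb #|E| ->
  N_acyclic emb N.
Proof.
move=> [_ _ nt] delK tm n /andP[n2 nN] g alpha [_ cyc].
have inv : involutory emb by move=> e; case: (nt e).
(* From here the cycle has [n.+1] cosets, numbered from 0 to [n], and [n < N] lets these numbers
   index the chain. *)
case: n n2 nN g alpha cyc => // n n1 nN g alpha cyc.
have inOrdS k : k < n -> ordS (inord k : 'I_n.+1) = inord k.+1.
  by move=> kn; apply: val_inj; rewrite /= !inordK ?modn_small // ltnW.
have inOrdP k : k < n -> ord_pred (inord k.+1 : 'I_n.+1) = inord k.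
  move=> kn; apply: val_inj; rewrite /= inordK // inordK; last exact: ltnW kn.
  by rewrite addSn /= modnDr modn_small // ltnW.
pose gg k := g (inord k); pose aa k := alpha (inord k).
pose C k := gg k *: subEgroup emb (aa k).
have conn k : k < n -> gg k.+1 \in C k.
  by move=> kn; have [] := cyc (inord k); rewrite inOrdS.
have Clast : gg 0 \in C n.
  have [] := cyc (inord n); rewrite (_ : ordS _ = inord 0) //.
  by apply: val_inj; rewrite /= !inordK // modnn.
have CE k x : x \in C k -> C k = x *: subEgroup emb (aa k) by move=> /lcoset_eqP.
have ggC k : gg k \in C k by apply: lcoset_refl.
(* By [subEgroupI], a common point of consecutive cosets lies in the smaller coset occurring in the
   separation condition. *)
have CI k x : k < n -> x \in C k -> x \in C k.+1 ->
    x \in gg k.+1 *: subEgroup emb (aa k.+1 :&: aa k).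
  move=> kn; rewrite (CE k (gg k.+1)) ?conn // !mem_lcoset => xk xk1.
  by rewrite subEgroupI // inE xk1.
have C3 k x : k.+1 < n -> x \in C k -> x \in C k.+1 -> x \in C k.+2 -> False.
  move=> kn xk xk1 xk2; have [_] := cyc (inord k.+1).
  rewrite inOrdS // inOrdP 1?ltnW // => /pred0P/(_ x)/negP; case.
  by rewrite /= CI 1?ltnW //= setIC CI.
(* In a cycle of length 2, connectivity puts [gg 0] in both cosets, against separation. *)
have n2 : 1 < n.
  rewrite ltn_neqAle; apply/andP; split=> //; apply/eqP=> n_1; subst n.
  have [_] := cyc (inord 0); rewrite inOrdS // => /pred0P/(_ (gg 0))/negP; case.
  by rewrite /= lcoset_refl setIC; apply: CI.
pose S : {ffun 'I_N -> {set gT}} := [ffun l : 'I_N => if l <= n then C l else set0].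
pose al : {ffun 'I_N -> {set E}} := [ffun l : 'I_N => aa l].
have SP (l : 'I_N) x : (x \in S l) = (l <= n) && (x \in C l).
  by rewrite ffunE; case: ifP; rewrite ?inE.
have chS : chain (@near N) emb S al.
  apply/and3P; split.
  - apply/forallP=> l; apply/forall_inP=> x; rewrite SP => /andP[ln xl].
    by rewrite !ffunE ln -CE.
  - apply/forallP=> i; apply/forallP=> l; apply/implyP=> /and3P[/andP[il li]].
    case/set0Pn=> x /[!SP]/andP[iN _] /set0Pn[y /[!SP]/andP[lN _]].
    apply/set0Pn; exists (gg (maxn i l)); rewrite inE !SP iN lN /=.
    case: (ltngtP i l) => [il2 | li2 | ->]; last by rewrite ggC.
      have <- : i.+1 = l by apply/eqP; rewrite eqn_leq il2.
      by rewrite ggC andbT; apply: conn; rewrite (leq_trans il2).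
    have <- : l.+1 = i by apply/eqP; rewrite eqn_leq li2.
    by rewrite ggC; apply: conn; rewrite (leq_trans li2).
  apply/forallP=> x; apply/forallP=> i; apply/forallP=> j; apply/forallP=> l.
  apply/implyP=> /and5P[]; rewrite !SP => /andP[iN xi] /andP[jN xj] /andP[lN xl].
  rewrite /near => /andP[ij ji] /andP[jl lj]; apply/andP.
  split; rewrite leqNgt; apply/negP=> h.
    have jE : j = l.+1 :> nat by apply/eqP; rewrite eqn_leq jl -ltnS (leq_trans h).
    have iE : i = l.+2 :> nat by apply/eqP; rewrite eqn_leq h -jE ij.
    by apply: (C3 l x); rewrite -?iE // -?jE.
  have jE : j = i.+1 :> nat by apply/eqP; rewrite eqn_leq ji -ltnS (leq_trans h).
  have lE : l = i.+2 :> nat by apply/eqP; rewrite eqn_leq h -jE lj.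
  by apply: (C3 i x); rewrite -?lE // -?jE.
have nearxx : reflexive (@near N) by move=> i; rewrite /near leqnSn.
have nearC : symmetric (@near N) by move=> i j; rewrite /near andbC.
have /and3P[cS _ sS] := chS; have stS := coset_family_stable cS.
have N0 : 0 < N by apply: leq_trans nN.
pose o0 : 'I_N := Ordinal N0.
have walk k (kN : k < N) : k <= n -> exists w, ev emb w = (gg 0)^-1 * gg k /\
    run (@near N) emb S al w (vtx (@near N) S (gg 0) o0) =
    vtx (@near N) S (gg k) (Ordinal kN).
  elim: k kN => [|k IHk] kN kn.
    by exists [::]; rewrite ev_nil mulVg /= (bool_irrelevance kN N0).
  have kN' := ltnW kN; have [w [Ew Rw]] := IHk kN' (ltnW kn).
  have gk : gg k \in S (Ordinal kN') by rewrite SP ltnW //= ggC.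
  have gk1 : gg k.+1 \in S (Ordinal kN) by rewrite SP kn /= ggC.
  have := conn k kn; rewrite mem_lcoset => /mem_subEgroupP[u au Eu].
  exists (w ++ u); rewrite ev_cat Ew -Eu mulgA mulgK.
  have [|_] := run_in nearxx nearC (w := u) sS stS gk; first by rewrite ffunE.
  rewrite /run foldl_cat -!/(run _ _ _ _ _ _) Rw => ->; split=> //.
  (* The point [gg k.+1], reached in copy [k], is glued to its copy [k.+1]. *)
  rewrite -Eu mulKVg; apply: vtx_eq => //.
  by rewrite inE SP (ltnW kn) /= conn // andbT /near /= leqnn leqW.
have [w [Ew Rw]] := walk n nN (leqnn n).
have gn : gg n \in S (Ordinal nN) by rewrite SP leqnn ggC.
have := Clast; rewrite mem_lcoset => /mem_subEgroupP[u au Eu].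
have [|_ Ru] := run_in nearxx nearC (w := u) sS stS gn; first by rewrite ffunE.
have Ewu : ev emb (w ++ u) = 1 by rewrite ev_cat Ew -Eu mulgA mulgK mulVg.
have g0 : gg 0 \in S o0 by rewrite SP /= ggC.
have := tm [set: E] (w ++ u); rewrite cardsT => /(_ (leqnn _)) tm1.
have {tm1} : run (@near N) emb S al (w ++ u) (vtx (@near N) S (gg 0) o0) =
    vtx (@near N) S (gg 0) o0.
  by apply: tm1 => //; apply/allP=> e; rewrite inE.
rewrite /run foldl_cat -!/(run _ _ _ _ _ _) Rw Ru -Eu mulKVg => -[E0].
(* The class of [gg 0] at copy [n] would contain copy 0, making [n] and 0 near although [1 < n]. *)
have := mem_cls nearxx g0; rewrite -E0 inE => /andP[/andP[]].
by rewrite /= leqNgt n2.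
Qed.

Theorem mainTheorem1 (E : finType) (gT : finGroupType) (emb : E -> gT)
  (HG : is_Egroup emb) (N : nat) (HN : 2 <= N) :
  exists (hT : finGroupType) (f : E -> hT),
    [/\ is_Egroup f, Egeq f emb, N_acyclic f N &
        forall rho : {perm E}, Esymmetry emb rho -> Esymmetry f rho].
Proof.
have [kT [h [hE [psi [psiM psih]] delh symh]]] := deletion_closed_expansion HG.
have nearxx : reflexive (@near N) by move=> i; rewrite /near leqnSn.
have nearC : symmetric (@near N) by move=> i j; rewrite /near andbC.
(* No word has more than [#|E|] distinct letters, so this level of tameness covers all relations. *)
have [hT [f [fE [phi [phiM phif]] delf tf symf]]] :=
  tame_expansion nearxx nearC #|E| (Ordinal (ltnW HN)) hE delh.
exists hT, f; split=> //; last by move=> rho /symh/symf.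
- exists (psi \o phi); split=> [x y | e] /=; first by rewrite phiM psiM.
  by rewrite phif psih.
exact: tame_acyclic.
Qed.
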